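(* Let $n,m\ge 1$ be integers and let $\mathbf{k}=(k_1,\ldots,k_n)$ be an $n$-tuple of positive real numbers satisfying $\sum_{i=1}^n k_i=1$. If $\Theta\in\mathrm{Bad}(\mathbf{k},n,m)$, then $\mathrm{Bad}_\Theta(\mathbf{k},n,m)\subset\mathbb{R}^n$ is isotropically winning.
   Context: Notation: $|\cdot|$ is the supremum norm on $\mathbb{R}^m$; $\|\cdot\|$ is the distance from a real number to the nearest integer. For a real $n\times m$ matrix $\Theta=(\Theta_{ij})$ and $q\in\mathbb{Z}^m$, put $\Theta_i(q)=\sum_{j=1}^m q_j\Theta_{ij}$ for $1\le i\le n$. $\mathrm{Bad}(\mathbf{k},n,m)$ is the set of $\Theta\in\mathrm{Mat}_{n\times m}(\mathbb{R})$ such that $\inf_{q\in\mathbb{Z}^m\setminus\{0\}}\max_{1\le i\le n}\big(|q|^{mk_i}\|\Theta_i(q)\|\big)>0$. For $\Theta\in\mathrm{Mat}_{n\times m}(\mathbb{R})$, $\mathrm{Bad}_\Theta(\mathbf{k},n,m)$ is the set of $x=(x_1,\ldots,x_n)\in\mathbb{R}^n$ such that $\inf_{q\in\mathbb{Z}^m\setminus\{0\}}\max_{1\le i\le n}\big(|q|^{mk_i}\|\Theta_i(q)-x_i\|\big)>0$. A set $\mathcal{N}\subset\mathbb{R}^n$ is isotropically winning if for each $1\le d\le n$ and each $d$-dimensional affine subspace $\mathcal{A}\subset\mathbb{R}^n$ the intersection $\mathcal{N}\cap\mathcal{A}$ is $1/2$-winning in $\mathcal{A}$. Schmidt's game on a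 Euclidean space $\mathcal{A}$ with parameters $\alpha,\beta\in(0,1)$: Bob first chooses a closed Euclidean ball $B_0\subset\mathcal{A}$ of arbitrary positive radius. Then, alternately, Alice chooses a closed ball $A_s\subset B_s$ of radius $\alpha$ times that of $B_s$, and Bob chooses a closed ball $B_{s+1}\subset A_s$ of radius $\beta$ times that of $A_s$ (all balls are balls in $\mathcal{A}$). A set $S\subset\mathcal{A}$ is $\alpha$-winning in $\mathcal{A}$ if for every $\beta\in(0,1)$ Alice has a strategy guaranteeing that the unique point of $\bigcap_{s\ge 0}B_s$ lies in $S$. *)

(* Defs.v *)
From HB Require Import structures.
From mathcomp Require Import all_boot all_order all_algebra.
From mathcomp Require Import all_classical all_reals all_analysis.

Set Implicit Arguments.
Unset Strict Implicit.
Unset Printing Implicit Defensive.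

Import Order.TTheory GRing.Theory Num.Theory.
Import numFieldNormedType.Exports.

Local Open Scope classical_set_scope.
Local Open Scope ring_scope.

Definition dist_int (R : realType) (y : R) : R :=
  inf (range (fun z : int => `|y - z%:~R|)).

(* The library norm on matrices is the supremum norm. *)
Definition supnormz (R : realType) (m : nat) (q : 'rV[int]_m) : R :=
  `|map_mx intr q : 'rV[R]_m|.

Definition linform (R : realType) (n m : nat) (Theta : 'M[R]_(n, m))
    (i : 'I_n) (q : 'rV[int]_m) : R :=
  \sum_(j < m) (q 0 j)%:~R * Theta i j.

(* The default value 0 of the big maximum is harmless: the terms are
   nonnegative and there is at least one of them when [0 < n]. *)
Definition Bad (R : realType) (n m : nat) (k : 'I_n -> R) : set 'M[R]_(n, m) :=
  [set Theta | 0 < inf [set \big[Order.max/0]_(i < n)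
      (supnormz R q `^ (m%:R * k i) * dist_int (linform Theta i q))
    | q in [set q : 'rV[int]_m | q != 0]]].

Definition BadTheta (R : realType) (n m : nat) (k : 'I_n -> R)
    (Theta : 'M[R]_(n, m)) : set 'rV[R]_n :=
  [set x | 0 < inf [set \big[Order.max/0]_(i < n)
      (supnormz R q `^ (m%:R * k i) * dist_int (linform Theta i q - x 0 i))
    | q in [set q : 'rV[int]_m | q != 0]]].

Definition enorm (R : realType) (n : nat) (v : 'rV[R]_n) : R :=
  Num.sqrt (\sum_(i < n) v 0 i ^+ 2).

Definition affine_subspace (R : realType) (n d : nat) (A : set 'rV[R]_n) : Prop :=
  exists (p : 'rV[R]_n) (W : {vspace 'rV[R]_n}),
    \dim W = d /\ A = [set p + w | w in [set w | w \in W]].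

(* A move of the game is a ball given by its centre and its radius. *)
Definition gball (R : realType) (n : nat) : Type := ('rV[R]_n * R)%type.

Definition ball_in (R : realType) (n : nat) (A : set 'rV[R]_n)
    (b : gball R n) : set 'rV[R]_n :=
  [set x | A x /\ enorm (x - b.1) <= b.2].

Definition legal_move (R : realType) (n : nat) (A : set 'rV[R]_n) (c : R)
    (b b' : gball R n) : Prop :=
  [/\ A b'.1, b'.2 = c * b.2 & ball_in A b' `<=` ball_in A b].

(* A strategy maps the list [:: B_0; ...; B_s] of Bob's moves so far to A_s. *)
Definition strategy (R : realType) (n : nat) : Type := seq (gball R n) -> gball R n.

Definition alice_ball (R : realType) (n : nat) (sigma : strategy R n)
    (B : nat -> gball R n) (s : nat) : gball R n := sigma (mkseq B s.+1).

Definition bob_legal_at (R : realType) (n : nat) (A : set 'rV[R]_n) (beta : R)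
    (sigma : strategy R n) (B : nat -> gball R n) (s : nat) : Prop :=
  if s is t.+1 then legal_move A beta (alice_ball sigma B t) (B t.+1)
  else A (B 0%N).1 /\ 0 < (B 0%N).2.

(* Alice must answer legally as long as Bob has played legally, so she cannot
   win by making it impossible for Bob to move. *)
Definition winning_strategy (R : realType) (n : nat) (A : set 'rV[R]_n)
    (alpha beta : R) (S : set 'rV[R]_n) (sigma : strategy R n) : Prop :=
  forall B : nat -> gball R n,
    (forall s : nat,
        (forall t : nat, (t <= s)%N -> bob_legal_at A beta sigma B t) ->
        legal_move A alpha (B s) (alice_ball sigma B s)) /\
    ((forall s : nat, bob_legal_at A beta sigma B s) ->
      exists x : 'rV[R]_n,
        \bigcap_(s in [set: nat]) ball_in A (B s) = [set x] /\ S x).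

Definition winning_in (R : realType) (n : nat) (A : set 'rV[R]_n) (alpha : R)
    (S : set 'rV[R]_n) : Prop :=
  forall beta : R, 0 < beta < 1 ->
    exists sigma : strategy R n, winning_strategy A alpha beta S sigma.

Definition isotropically_winning (R : realType) (n : nat) (N : set 'rV[R]_n) : Prop :=
  forall d : nat, (1 <= d <= n)%N ->
  forall A : set 'rV[R]_n, affine_subspace d A ->
    winning_in A (1 / 2) (N `&` A).

(* Main.v *)
Require Import Defs.
From mathcomp Require Import all_boot all_order all_algebra.
From mathcomp Require Import all_classical all_reals all_analysis.
From mathcomp Require Import ring lra.
Import Order.TTheory GRing.Theory Num.Theory.
Import numFieldNormedType.Exports.
Local Open Scope classical_set_scope.
Local Open Scope ring_scope.

(** Fix an affine subspace [A] and let [i0] maximize [k] among the coordinates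
    that are not constant on [A]. For a ball of radius [r] in [A], consider the
    [q] with [|q|^(m k_i0)] comparable to a small multiple of [1/r]. If two of
    them, [q] and [q'], came too close to points of the ball, then [q - q']
    would contradict [Theta] being badly approximable: in a coordinate [i]
    which varies on [A] one has [k_i <= k_i0], so that [2r] is negligible
    against [|q - q'|^(- m k_i)], and the other coordinates do not vary. Hence
    a single [q] is dangerous, and its danger zone lies in a thin slab around a
    hyperplane [x_i0 = const]. Alice escapes that slab in two rounds by moving
    twice, as far as she can, to the same side: the first move only guarantees
    that she does not cross the centre of Bob's ball, the second one gains a
    definite proportion of [r]. Every [q] is dealt with at some stage since the
    radii decrease geometrically; the constant of [Bad_Theta] may depend on
    Bob's first radius, which lets the first stage absorb all small [q]. *)

Set Implicit Arguments.
Unset Strict Implicit.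

(** * The Euclidean inner product and norm *)

Definition dot (R : realType) (n : nat) (x y : 'rV[R]_n) : R :=
  \sum_(i < n) x 0 i * y 0 i.

Lemma dotE (R : realType) (n : nat) (x y : 'rV[R]_n) :
  dot x y = (x *m y^T) 0 0.
Proof. by rewrite mxE; apply: eq_bigr => i _; rewrite mxE. Qed.

Lemma dotC (R : realType) (n : nat) (x y : 'rV[R]_n) : dot x y = dot y x.
Proof. by apply: eq_bigr => i _; rewrite mulrC. Qed.

Lemma dotDr (R : realType) (n : nat) (x y z : 'rV[R]_n) :
  dot x (y + z) = dot x y + dot x z.
Proof. by rewrite !dotE linearD mulmxDr mxE. Qed.

Lemma dotZr (R : realType) (n : nat) (a : R) (x y : 'rV[R]_n) :
  dot x (a *: y) = a * dot x y.
Proof. by rewrite !dotE linearZ -scalemxAr mxE. Qed.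

Lemma dotNr (R : realType) (n : nat) (x y : 'rV[R]_n) :
  dot x (- y) = - dot x y.
Proof. by rewrite -scaleN1r dotZr mulN1r. Qed.

Lemma dotDl (R : realType) (n : nat) (x y z : 'rV[R]_n) :
  dot (x + y) z = dot x z + dot y z.
Proof. by rewrite dotC dotDr !(dotC _ z). Qed.

Lemma dotZl (R : realType) (n : nat) (a : R) (x y : 'rV[R]_n) :
  dot (a *: x) y = a * dot x y.
Proof. by rewrite dotC dotZr dotC. Qed.

Lemma dot_ge0 (R : realType) (n : nat) (x : 'rV[R]_n) : 0 <= dot x x.
Proof. by apply: sumr_ge0 => i _; rewrite -expr2 sqr_ge0. Qed.

Lemma dot_eq0 (R : realType) (n : nat) (x : 'rV[R]_n) : dot x x = 0 -> x = 0.
Proof.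
move=> /eqP; rewrite psumr_eq0; last by move=> i _; rewrite -expr2 sqr_ge0.
move=> /allP h; apply/rowP => i; rewrite mxE.
by have := h i (mem_index_enum i); rewrite -expr2 sqrf_eq0 => /eqP.
Qed.

Lemma enorm_dot (R : realType) (n : nat) (x : 'rV[R]_n) :
  enorm x = Num.sqrt (dot x x).
Proof. by congr Num.sqrt; apply: eq_bigr => i _; rewrite expr2. Qed.

Lemma enorm_ge0 (R : realType) (n : nat) (x : 'rV[R]_n) : 0 <= enorm x.
Proof. exact: sqrtr_ge0. Qed.

Lemma sqr_enorm (R : realType) (n : nat) (x : 'rV[R]_n) :
  enorm x ^+ 2 = dot x x.
Proof. by rewrite enorm_dot sqr_sqrtr ?dot_ge0. Qed.

Lemma enorm_eq0 (R : realType) (n : nat) (x : 'rV[R]_n) : enorm x = 0 -> x = 0.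
Proof. by move=> h; apply: dot_eq0; rewrite -sqr_enorm h expr0n. Qed.

Lemma enormZ (R : realType) (n : nat) (a : R) (x : 'rV[R]_n) :
  enorm (a *: x) = `|a| * enorm x.
Proof.
by rewrite !enorm_dot dotZl dotZr mulrA -expr2 sqrtrM ?sqr_ge0 // sqrtr_sqr.
Qed.

Lemma enormN (R : realType) (n : nat) (x : 'rV[R]_n) : enorm (- x) = enorm x.
Proof. by rewrite -scaleN1r enormZ normrN1 mul1r. Qed.

Lemma enormB (R : realType) (n : nat) (x y : 'rV[R]_n) :
  enorm (x - y) = enorm (y - x).
Proof. by rewrite -enormN opprB. Qed.

Lemma enorm0 (R : realType) (n : nat) : enorm (0 : 'rV[R]_n) = 0.
Proof. by rewrite -(scale0r 0) enormZ normr0 mul0r. Qed.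

(** Cauchy-Schwarz: expand the square of [enorm y *: x - enorm x *: y] and divide by the product of
    the norms, whence the separate null cases. *)
Lemma dot_le_enorm (R : realType) (n : nat) (x y : 'rV[R]_n) :
  dot x y <= enorm x * enorm y.
Proof.
have [->|x0] := eqVneq x 0.
  by rewrite enorm0 mul0r -(scale0r 0) dotZl mul0r.
have [->|y0] := eqVneq y 0.
  by rewrite enorm0 mulr0 -(scale0r 0) dotZr mul0r.
have ex : 0 < enorm x.
  by rewrite lt_def enorm_ge0 andbT; apply: contra x0 => /eqP/enorm_eq0->.
have ey : 0 < enorm y.
  by rewrite lt_def enorm_ge0 andbT; apply: contra y0 => /eqP/enorm_eq0->.
have := dot_ge0 (enorm y *: x - enorm x *: y).
rewrite -scaleNr !(dotDl, dotDr, dotZl, dotZr) (dotC y x) -!sqr_enorm.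
have exy := mulr_gt0 ex ey => h.
rewrite -(ler_pM2l exy); move: h; set a := enorm x; set b := enorm y.
nra.
Qed.

Lemma ler_enormD (R : realType) (n : nat) (x y : 'rV[R]_n) :
  enorm (x + y) <= enorm x + enorm y.
Proof.
rewrite -(@ler_pXn2r _ 2) ?nnegrE ?addr_ge0 ?enorm_ge0 //.
rewrite sqr_enorm !(dotDl, dotDr) (dotC y x) -!sqr_enorm sqrrD.
have := dot_le_enorm x y; lra.
Qed.

Lemma ler_enormB (R : realType) (n : nat) (y x z : 'rV[R]_n) :
  enorm (x - z) <= enorm (x - y) + enorm (y - z).
Proof. by rewrite -[x - z](subrKA y) ler_enormD. Qed.

Lemma coord_le_enorm (R : realType) (n : nat) (x : 'rV[R]_n) (i : 'I_n) :
  `|x 0 i| <= enorm x.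
Proof.
rewrite -sqrtr_sqr ler_wsqrtr // (bigD1 i) //= lerDl.
by apply: sumr_ge0 => j _; exact: sqr_ge0.
Qed.

(** The factor [n], in place of its square root, is harmless: the bound is applied only to radii
    that tend to [0]. *)
Lemma enorm_le_coord (R : realType) (n : nat) (x : 'rV[R]_n) (a : R) :
  0 <= a -> (forall i, `|x 0 i| <= a) -> enorm x <= n%:R * a.
Proof.
move=> a0 h.
have na0 : 0 <= n%:R * a by rewrite mulr_ge0.
rewrite -(ger0_norm na0) -sqrtr_sqr ler_wsqrtr //.
apply: (@le_trans _ _ (\sum_(i < n) a ^+ 2)).
  apply: ler_sum => i _; rewrite -real_normK ?num_real //.
  by rewrite ler_pXn2r ?nnegrE.
rewrite sumr_const card_ord -[_ *+ _]mulr_natl exprMn ler_wpM2r ?sqr_ge0 //.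
by rewrite -natrX ler_nat; case: (n) => // k; rewrite -mulnn leq_pmulr.
Qed.

(** * Linear and affine subspaces *)

(** Riesz representation of a coordinate on [W]. The Gram matrix [G] of a basis is invertible: if
    [a *m G = 0], then [a *m M] is orthogonal to itself, hence null, and [a = 0] by freeness.
    Solving against [G] gives [v]; when nonzero, it points where coordinate [i] grows fastest in
    [W]. *)
Lemma coord_riesz (R : realType) (n : nat) (W : {vspace 'rV[R]_n}) (i : 'I_n) :
  exists2 v : 'rV[R]_n, v \in W & forall w, w \in W -> dot v w = w 0 i.
Proof.
pose M : 'M[R]_(\dim W, n) := \matrix_(j < \dim W) (vbasis W)`_j.
have inW (a : 'rV_(\dim W)) : a *m M = \sum_j a 0 j *: (vbasis W)`_j.
  by rewrite mulmx_sum_row; apply: eq_bigr => j _; rewrite rowK.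
pose G := M *m M^T.
have Gu : G \in unitmx.
  rewrite -row_free_unit; apply/row_freeP.
  have : row_free G.
    rewrite -kermx_eq0; apply/eqP/row_matrixP => j; rewrite row0.
    set a := row j _.
    have aG : a *m G = 0 by apply/sub_kermxP; exact: row_sub.
    have aM : a *m M = 0.
      apply: dot_eq0; rewrite dotE trmx_mul mulmxA -(mulmxA a M) aG.
      by rewrite mul0mx mxE.
    move: aM; rewrite inW => aM.
    have /freeP fW := basis_free (vbasisP W).
    by apply/rowP => l; rewrite (fW _ aM) mxE.
  by move=> /row_freeP.
pose e := (col i M)^T *m invmx G.
exists (e *m M).
  rewrite inW; apply: memv_suml => j _; apply: memvZ.
  by apply: vbasis_mem; apply: mem_nth; rewrite size_tuple.
move=> w wW.
have -> : w = (\row_j coord (vbasis W) j w) *m M.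
  by rewrite inW {1}(coord_vbasis wW); apply: eq_bigr => j _; rewrite mxE.
set a := \row_j _.
rewrite dotE trmx_mul mulmxA -(mulmxA e) mulmxKV //.
by rewrite !mxE; apply: eq_bigr => j _; rewrite !mxE mulrC.
Qed.

Definition affine (R : realType) (n : nat) (p : 'rV[R]_n) (W : {vspace 'rV[R]_n}) :
    set 'rV[R]_n :=
  [set p + w | w in [set w | w \in W]].

Lemma affineP (R : realType) (n : nat) (p : 'rV[R]_n) (W : {vspace 'rV[R]_n})
    (x : 'rV[R]_n) : affine p W x <-> x - p \in W.
Proof.
split=> [[w /= wW <-]|xW]; first by rewrite addrC addKr.
by exists (x - p) => //; rewrite addrC subrK.
Qed.

Lemma affineB (R : realType) (n : nat) (p : 'rV[R]_n) (W : {vspace 'rV[R]_n})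
    (x y : 'rV[R]_n) : affine p W x -> affine p W y -> x - y \in W.
Proof.
move=> /affineP xW /affineP yW.
have -> : x - y = (x - p) - (y - p) by rewrite opprB addrA subrK.
exact: rpredB.
Qed.

Lemma affineD (R : realType) (n : nat) (p : 'rV[R]_n) (W : {vspace 'rV[R]_n})
    (x w : 'rV[R]_n) : affine p W x -> w \in W -> affine p W (x + w).
Proof.
by move=> /affineP xW wW; apply/affineP; rewrite addrAC; apply: rpredD.
Qed.

(** * Limits, closedness and nested balls *)

Lemma ler_limit0 (R : realType) (a C : R) :
  (forall e : R, 0 < e -> a <= C * e) -> a <= 0.
Proof.
move=> h; rewrite leNgt; apply/negP => a0.
have C1 : 0 < `|C| + 1 by rewrite ltr_wpDl.
have e0 : 0 < a / (`|C| + 1) / 2 by rewrite !divr_gt0.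
have := h _ e0; rewrite leNgt => /negP; apply.
apply: (@le_lt_trans _ _ ((`|C| + 1) * (a / (`|C| + 1) / 2))).
  by rewrite ler_wpM2r ?(ltW e0) // (le_trans (ler_norm _)) // lerDl.
rewrite mulrA mulrCA divff ?gt_eqF //; lra.
Qed.

(** The map [f], identity minus projection onto [W], vanishes exactly on [W] and is Lipschitz with
    constant [C]; hence [f (x - p) = f (x - y)] is arbitrarily small. *)
Lemma affine_closed (R : realType) (n : nat) (p : 'rV[R]_n) (W : {vspace 'rV[R]_n})
    (x : 'rV[R]_n) :
  (forall e : R, 0 < e -> exists2 y, affine p W y & enorm (x - y) <= e) ->
  affine p W x.
Proof.
move=> h; apply/affineP.
pose f : 'rV[R]_n -> 'rV[R]_n := fun v => v - projv W v.
suff : f (x - p) = 0 by move=> /eqP; rewrite subr_eq0 => /eqP ->; exact: memv_proj.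
have fW w : w \in W -> f w = 0 by move=> wW; rewrite /f projv_id ?subrr.
have fD u v : f (u + v) = f u + f v by rewrite /f linearD opprD addrACA.
have fs v : f v = \sum_(j < n) v 0 j *: f (delta_mx 0 j).
  rewrite {1}/f {1 2}(row_sum_delta v) linear_sum -sumrB.
  by apply: eq_bigr => j _; rewrite linearZ scalerBr.
pose C := \sum_(j < n) enorm (f (delta_mx 0 j)).
have fC v : enorm (f v) <= C * enorm v.
  rewrite fs /C mulr_suml.
  elim/big_rec2: _ => [|j a w _ le]; first by rewrite enorm0.
  apply: (le_trans (ler_enormD _ _)); apply: lerD => //.
  by rewrite enormZ mulrC ler_wpM2l ?enorm_ge0 // coord_le_enorm.
apply: enorm_eq0; apply/le_anti; rewrite enorm_ge0 andbT.
apply: (@ler_limit0 _ _ C) => e /h[y yA xy].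
have -> : f (x - p) = f (x - y).
  have -> : x - p = (x - y) + (y - p) by rewrite addrA subrK.
  by rewrite fD [f (y - p)]fW ?addr0 //; exact/affineP.
apply: (le_trans (fC _)); rewrite ler_wpM2l //.
by apply: sumr_ge0 => j _; exact: enorm_ge0.
Qed.

(** The common point is built coordinate by coordinate, as the supremum of the lower ends of the
    projected balls. It lies in the subspace because it is a limit of centres. *)
Lemma nested_balls (R : realType) (n : nat) (p : 'rV[R]_n) (W : {vspace 'rV[R]_n})
    (B : nat -> gball R n) :
  (forall s, affine p W (B s).1) -> (forall s, 0 <= (B s).2) ->
  (forall s, ball_in (affine p W) (B s.+1) `<=` ball_in (affine p W) (B s)) ->
  (forall e : R, 0 < e -> exists s, (B s).2 <= e) ->
  exists x, \bigcap_(s in [set: nat]) ball_in (affine p W) (B s) = [set x].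
Proof.
move=> BA B0 Bsub Bsmall.
have BsubD s t : ball_in (affine p W) (B (s + t)%N) `<=` ball_in (affine p W) (B s).
  by elim: t => [|t IH]; rewrite ?addn0 // addnS; apply: subset_trans IH.
have cs s : ball_in (affine p W) (B s) (B s).1.
  by split; rewrite ?subrr ?enorm0.
have dist s t : enorm ((B t).1 - (B s).1) <= (B s).2 + (B t).2.
  wlog st : s t / (s <= t)%N.
    move=> h; case/orP: (leq_total s t) => [|/h]; first exact: h.
    by rewrite enormB [X in _ <= X]addrC.
  apply: (@le_trans _ _ (B s).2); last by rewrite lerDl.
  by rewrite -(subnKC st); case: (BsubD s (t - s)%N _ (cs _)).
pose E j := [set (B s).1 0 j - (B s).2 | s in [set: nat]].
have Eub j t : ubound (E j) ((B t).1 0 j + (B t).2).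
  move=> _ [s _ <-]; have := dist t s.
  have := coord_le_enorm ((B s).1 - (B t).1) j; rewrite !mxE ler_norml => /andP[].
  by lra.
have Esup j : has_sup (E j).
  split; first by exists ((B 0%N).1 0 j - (B 0%N).2), 0%N.
  by exists ((B 0%N).1 0 j + (B 0%N).2).
pose x : 'rV[R]_n := \row_j sup (E j).
have xB s j : `|(x - (B s).1) 0 j| <= (B s).2.
  have h1 : sup (E j) <= (B s).1 0 j + (B s).2 by apply: ge_sup; [case: (Esup j)|].
  have h2 : (B s).1 0 j - (B s).2 <= sup (E j).
    by apply: ub_le_sup; [case: (Esup j)|exists s].
  rewrite !mxE ler_norml; lra.
have xn s : enorm (x - (B s).1) <= n%:R * (B s).2 by apply: enorm_le_coord.
have xA : affine p W x.
  apply: affine_closed => e e0.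
  have [s sle] := Bsmall (e / (n%:R + 1)) (divr_gt0 e0 (ltr_wpDl (ler0n _ _) ltr01)).
  exists (B s).1 => //; apply: (le_trans (xn s)).
  apply: (@le_trans _ _ ((n%:R + 1) * (e / (n%:R + 1)))).
    by apply: ler_pM => //; rewrite lerDl.
  by rewrite mulrC divfK // gt_eqF // ltr_wpDl.
(* So far [x] is only within [n%:R * (B s).2] of the centre. Passing through the centre of a much
   smaller ball [B t] costs [(B s).2 + (n%:R + 1) * e], and [e] is arbitrary. *)
have xin s : ball_in (affine p W) (B s) x.
  split=> //; rewrite -subr_le0; apply: (@ler_limit0 _ _ (n%:R + 1)) => e e0.
  have [t tle] := Bsmall e e0.
  have := ler_enormB (B t).1 x (B s).1; have := dist s t; have := xn t.
  have : n%:R * (B t).2 <= n%:R * e by rewrite ler_wpM2l.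
  rewrite mulrDl mul1r; lra.
exists x; apply/seteqP; split => [y yB|_ -> s _]; last exact: xin.
apply/eqP; rewrite -subr_eq0; apply/eqP/enorm_eq0/le_anti; rewrite enorm_ge0 andbT.
apply: (@ler_limit0 _ _ 2) => e /Bsmall[s se].
have [_ ys] := yB s I; have [_ xs] := xin s.
have := ler_enormB (B s).1 y x; rewrite (enormB (B s).1); lra.
Qed.

Lemma geometric_small (R : realType) (a b e : R) :
  0 <= b < 1 -> 0 < e -> exists s, a * b ^+ s <= e.
Proof.
move=> /andP[b0 b1] e0.
have := @cvg_geometric R a b; rewrite ger0_norm // => /(_ b1) /cvgrPdist_le /(_ e e0).
move=> [s _ /(_ s (leqnn s))] /=; rewrite sub0r normrN => h.
by exists s; apply: le_trans h; rewrite ler_norm.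
Qed.

(** * Schmidt's game: pushing twice in one direction *)

(** For a unit [v], this ball is internally tangent to [b] at its extreme point in direction [v]. *)
Definition push_ball (R : realType) (n : nat) (b : gball R n) (v : 'rV[R]_n) :
    gball R n :=
  (b.1 + (b.2 / 2) *: v, 1 / 2 * b.2).

Lemma push_ball_legal (R : realType) (n : nat) (p : 'rV[R]_n)
    (W : {vspace 'rV[R]_n}) (b : gball R n) (v : 'rV[R]_n) :
  affine p W b.1 -> 0 <= b.2 -> v \in W -> enorm v = 1 ->
  legal_move (affine p W) (1 / 2) b (push_ball b v).
Proof.
move=> bA b0 vW v1; split=> //=; first by apply: affineD => //; apply: memvZ.
move=> x [xA /= xb]; split=> //.
have := ler_enormB (b.1 + (b.2 / 2) *: v) x b.1.
rewrite (addrC b.1) addrK enormZ v1 mulr1 ger0_norm ?divr_ge0 // addrC in xb *.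
lra.
Qed.

(** The centre is shifted by exactly the new radius, so by Cauchy-Schwarz the pushed ball stays on
    the positive side of the old centre. *)
Lemma push_ball_dot (R : realType) (n : nat) (A : set 'rV[R]_n) (b : gball R n)
    (v x : 'rV[R]_n) :
  enorm v = 1 -> ball_in A (push_ball b v) x -> dot v b.1 <= dot v x.
Proof.
move=> v1 [_ /= h]; have := dot_le_enorm v (b.1 + (b.2 / 2) *: v - x).
rewrite v1 mul1r enormB => /le_trans /(_ h).
by rewrite !(dotDr, dotNr, dotZr) -sqr_enorm v1; lra.
Qed.

(** Reduces the game to countably many goals [G t], which may depend on Bob's first radius [r0].
    Goal [t] is handled in rounds [2t] and [2t+1], both pushed in the direction [v] chosen at the
    centre [b] of [B_(2t)], whose radius is [r0 * (beta / 2) ^+ t.*2]. *)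
Lemma push_twice_winning (R : realType) (n : nat) (p : 'rV[R]_n)
    (W : {vspace 'rV[R]_n}) (beta : R) (S : set 'rV[R]_n) :
  0 < beta < 1 ->
  (forall r0 : R, 0 < r0 -> exists G : nat -> set 'rV[R]_n,
    (forall x, affine p W x -> (forall t, G t x) -> S x) /\
    (forall t b, affine p W b -> exists v, [/\ v \in W, enorm v = 1 &
      forall x, affine p W x ->
        enorm (x - b) <= r0 * (beta / 2) ^+ t.*2 ->
        r0 * (beta / 2) ^+ t.*2 * (beta / 2) <= dot v (x - b) -> G t x])) ->
  exists sigma : strategy R n, winning_strategy (affine p W) (1 / 2) beta S sigma.
Proof.
move=> /andP[beta0 beta1] H.
set A := affine p W.
pose good r0 (Gd : (nat -> set 'rV[R]_n) * (nat -> 'rV[R]_n -> 'rV[R]_n)) :=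
  (forall x, A x -> (forall t, Gd.1 t x) -> S x) /\
  (forall t b, A b -> [/\ Gd.2 t b \in W, enorm (Gd.2 t b) = 1 &
      forall x, A x ->
        enorm (x - b) <= r0 * (beta / 2) ^+ t.*2 ->
        r0 * (beta / 2) ^+ t.*2 * (beta / 2) <= dot (Gd.2 t b) (x - b) ->
        Gd.1 t x]).
(* Goals and directions are chosen for all radii at once, with junk values for [r0 <= 0], so that a
   strategy can read them off Bob's moves. *)
have /choice[F FP] : forall r0 : R, exists Gd, 0 < r0 -> good r0 Gd.
  move=> r0; have [r00|r00] := boolP (0 < r0); last first.
    by exists (fun=> set0, fun=> id).
  have [G [GS Gv]] := H _ r00.
  have /choice[D DP] : forall tb : nat * 'rV[R]_n, exists v, A tb.2 ->
      [/\ v \in W, enorm v = 1 & forall x, A x ->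
        enorm (x - tb.2) <= r0 * (beta / 2) ^+ tb.1.*2 ->
        r0 * (beta / 2) ^+ tb.1.*2 * (beta / 2) <= dot v (x - tb.2) -> G tb.1 x].
    move=> [t b] /=; have [bA|bA] := pselect (A b); last by exists 0.
    by have [v] := Gv t b bA; exists v.
  exists (G, fun t b => D (t, b)) => _; split=> //= t b bA.
  exact: (DP (t, b) bA).
pose b0 : gball R n := (0, 0).
(* Here [(size l).-1] is the current round; halving it gives the goal [t], and doubling back gives
   the even round whose centre fixes the direction. Both rounds of a pair thus share one
   direction. *)
pose dir (l : seq (gball R n)) : 'rV[R]_n :=
  (F (nth b0 l 0).2).2 (size l).-1./2 (nth b0 l (size l).-1./2.*2).1.
exists (fun l : seq (gball R n) => push_ball (last b0 l) (dir l)) => B.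
set sigma : strategy R n := fun l => _.
have half_le s : (s./2.*2 <= s)%N by rewrite -{2}(odd_double_half s) leq_addl.
have sigmaE s : alice_ball sigma B s =
    push_ball (B s) ((F (B 0%N).2).2 s./2 (B s./2.*2).1).
  rewrite /alice_ball /sigma; congr push_ball; last first.
    by rewrite /dir size_mkseq !nth_mkseq // ltnS.
  by rewrite -nth_last size_mkseq nth_mkseq.
have radius s : (forall t, (t <= s)%N -> bob_legal_at A beta sigma B t) ->
    [/\ 0 < (B 0%N).2, A (B s).1 & (B s).2 = (B 0%N).2 * (beta / 2) ^+ s].
  elim: s => [|s IH] h.
    by have [] := h 0%N (leqnn _); rewrite mulr1.
  have [r0 _ rs] := IH (fun t ts => h t (leqW ts)).
  have [cA -> _] := h s.+1 (leqnn _); split=> //.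
  by rewrite sigmaE /= rs exprS; field.
have b20 : 0 < beta / 2 by lra.
have legal s : (forall t, (t <= s)%N -> bob_legal_at A beta sigma B t) ->
    legal_move A (1 / 2) (B s) (alice_ball sigma B s).
  move=> h; have [r0 cA rs] := radius s h; rewrite sigmaE.
  have [_ cA' _] := radius s./2.*2 (fun t ts => h t (leq_trans ts (half_le s))).
  have [_ /(_ s./2 _ cA')[dW d1 _]] := FP _ r0.
  by apply: push_ball_legal => //; rewrite rs mulr_ge0 ?exprn_ge0 ?ltW.
split=> // h.
have rad s : [/\ 0 < (B 0%N).2, A (B s).1 & (B s).2 = (B 0%N).2 * (beta / 2) ^+ s].
  exact: radius.
have r0 : 0 < (B 0%N).2 by have [] := rad 0%N.
have BA s : A (B s).1 by have [] := rad s.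
have rE s : (B s).2 = (B 0%N).2 * (beta / 2) ^+ s by have [] := rad s.
have rs0 s : 0 <= (B s).2 by rewrite rE mulr_ge0 ?exprn_ge0 ?ltW.
have leg s : legal_move A (1 / 2) (B s) (alice_ball sigma B s).
  by apply: legal => t _; exact: h.
have Asub s : ball_in A (B s.+1) `<=` ball_in A (alice_ball sigma B s).
  by case: (h s.+1).
have [s|e e0|x xB] := @nested_balls R n p W B BA rs0.
- by apply: subset_trans (Asub s) _; case: (leg s).
- have [|s hs] := @geometric_small R (B 0%N).2 (beta / 2) e _ e0.
    by rewrite ltW //=; lra.
  by exists s; rewrite rE.
exists x; split=> //.
have xin s : ball_in A (B s) x.
  have : (\bigcap_(s in [set: nat]) ball_in (affine p W) (B s)) x by rewrite xB.
  exact.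
have [FS Fdir] := FP _ r0.
apply: FS; first by case: (xin 0%N).
move=> t; have [vW v1] := Fdir t (B t.*2).1 (BA _).
set v := (F _).2 _ _ in vW v1 *; apply; first by case: (xin 0%N).
  by rewrite -rE; case: (xin t.*2).
have Ae : alice_ball sigma B t.*2 = push_ball (B t.*2) v by rewrite sigmaE doubleK.
have Ao : alice_ball sigma B t.*2.+1 = push_ball (B t.*2.+1) v.
  by rewrite sigmaE /= uphalf_double.
have := Asub t.*2.+1 _ (xin t.*2.+2); rewrite Ao => /(push_ball_dot v1).
(* The lowest point of [B_(2t+1)] in direction [v] is still above the centre of [B_(2t)]. *)
pose y := (B t.*2.+1).1 - (B t.*2.+1).2 *: v.
have yB : ball_in A (B t.*2.+1) y.
  split; first by rewrite /y -scaleNr; apply: affineD; [exact: BA|exact: memvZ].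
  by rewrite /y addrAC subrr sub0r enormN enormZ v1 mulr1 ger0_norm.
have := Asub t.*2 _ yB; rewrite Ae => /(push_ball_dot v1).
have vv : dot v v = 1 by rewrite -sqr_enorm v1 expr1n.
(* The final point is above the centre of [B_(2t+1)], itself at least one radius of [B_(2t+1)] above
   the centre of [B_(2t)]: this radius is the required gain. *)
rewrite /y !(dotDr, dotNr, dotZr) vv mulr1 rE exprSr mulrA; lra.
Qed.

(** * Diophantine approximation and dangerous vectors *)

Lemma dist_int_le (R : realType) (y : R) (z : int) : dist_int y <= `|y - z%:~R|.
Proof. by apply: ge_inf; [exists 0 => _ [w _ <-]; exact: normr_ge0 | exists z]. Qed.

Lemma le_dist_int (R : realType) (y e : R) :
  (forall z : int, e <= `|y - z%:~R|) -> e <= dist_int y.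
Proof.
move=> h; apply: lb_le_inf; first by exists `|y - 0%:~R|, 0.
by move=> _ [z _ <-].
Qed.

Lemma supnormz_ge1 (R : realType) (m : nat) (q : 'rV[int]_m) :
  q != 0 -> 1 <= supnormz R q.
Proof.
move=> /rV0Pn[j qj].
apply: (@le_trans _ _ `|(map_mx intr q : 'rV[R]_m) 0 j|).
  by rewrite mxE norm_intr_ge1 ?intr_int // intr_eq0.
rewrite /supnormz {2}/Num.Def.normr /= mx_normrE.
exact: (le_bigmax 0 (fun ij => `|(map_mx intr q : 'rV[R]_m) ij.1 ij.2|) (0, j)).
Qed.

Lemma supnormzB (R : realType) (m : nat) (q q' : 'rV[int]_m) :
  supnormz R (q - q') <= supnormz R q + supnormz R q'.
Proof. by rewrite /supnormz map_mxB ler_normB. Qed.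

Lemma linformB (R : realType) (n m : nat) (Theta : 'M[R]_(n, m)) (i : 'I_n)
    (q q' : 'rV[int]_m) :
  linform Theta i (q - q') = linform Theta i q - linform Theta i q'.
Proof.
rewrite /linform -sumrB; apply: eq_bigr => j _.
by rewrite !mxE rmorphB mulrBl.
Qed.

Lemma Bad_lower_bound (R : realType) (n m : nat) (k : 'I_n -> R)
    (Theta : 'M[R]_(n, m)) :
  Bad k Theta -> exists2 c : R, 0 < c & forall q, q != 0 ->
    exists i, forall z : int,
      c <= supnormz R q `^ (m%:R * k i) * `|linform Theta i q - z%:~R|.
Proof.
rewrite /Bad /=; set E := [set _ | _ in _] => E0; exists (inf E) => // q q0.
have : inf E <= \big[Order.max/0]_(i < n)
      (supnormz R q `^ (m%:R * k i) * dist_int (linform Theta i q)).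
  apply: ge_inf; last by exists q.
  by exists 0 => _ [p _ <-]; exact: bigmax_ge_id.
(* The infimum is positive, so it is not reached through the default [0] of the maximum, and some
   index must attain it. *)
move=> /bigmax_geP[|[i _ h]]; first by rewrite leNgt E0.
exists i => z; apply: (le_trans h).
by rewrite ler_wpM2l ?powR_ge0 // dist_int_le.
Qed.

(** The vector [q] is dangerous at [x], at level [e]. Integer witnesses replace [dist_int], so that
    those of two vectors can be subtracted. *)
Definition eps_close (R : realType) (n m : nat) (k : 'I_n -> R)
    (Theta : 'M[R]_(n, m)) (e : R) (q : 'rV[int]_m) (x : 'rV[R]_n) : Prop :=
  forall i, exists z : int,
    supnormz R q `^ (m%:R * k i) * `|linform Theta i q - x 0 i - z%:~R| < e.

Lemma not_eps_close_BadTheta (R : realType) (n m : nat) (k : 'I_n -> R)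
    (Theta : 'M[R]_(n, m)) (e : R) (x : 'rV[R]_n) : (0 < m)%N ->
  0 < e -> (forall q, q != 0 -> ~ eps_close k Theta e q x) -> BadTheta k Theta x.
Proof.
move=> m0 e0 h; apply: (lt_le_trans e0); apply: lb_le_inf.
  (* A lower bound passes to the infimum of a nonempty set; a nonzero [q] exists because [0 < m]. *)
  exists (\big[Order.max/0]_(i < n) (supnormz R (const_mx 1 : 'rV[int]_m)
    `^ (m%:R * k i) * dist_int (linform Theta i (const_mx 1) - x 0 i))).
  exists (const_mx 1) => //=; apply/rV0Pn; exists (Ordinal m0).
  by rewrite mxE.
move=> _ [q /= q0 <-].
have /existsNP[i /forallNP hi] := h q q0.
apply: (bigmax_sup i) => //.
have S0 : 0 < supnormz R q `^ (m%:R * k i).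
  by apply/powR_gt0/(lt_le_trans ltr01)/supnormz_ge1.
rewrite mulrC -ler_pdivrMr //; apply: le_dist_int => z.
by rewrite ler_pdivrMr // mulrC leNgt; apply/negP.
Qed.

(** If [q] and [q'] differ, the bad approximability bound for [q - q'] holds at some [i]. There the
    error splits into those of [q] and [q'] and the variation of [x 0 i]; after weighting they are
    at most [c / 8], [c / 8] and [c / 4], which is too small. *)
Lemma eps_close_unique (R : realType) (n m : nat) (k : 'I_n -> R)
    (Theta : 'M[R]_(n, m)) (c kap L Y r e : R) (q q' : 'rV[int]_m)
    (x x' : 'rV[R]_n) :
  (forall i, 0 < k i <= 1) -> 0 < kap -> 0 < c -> 0 <= L -> 0 <= r ->
  (forall q, q != 0 -> exists i, forall z : int,
      c <= supnormz R q `^ (m%:R * k i) * `|linform Theta i q - z%:~R|) ->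
  q != 0 -> q' != 0 ->
  supnormz R q' <= L * supnormz R q -> supnormz R q <= L * supnormz R q' ->
  supnormz R q `^ (m%:R * kap) <= Y -> supnormz R q' `^ (m%:R * kap) <= Y ->
  2 `^ (m%:R * kap) * r * Y <= c / 8 -> (1 + L) `^ m%:R * e <= c / 8 ->
  (forall i, `|x 0 i - x' 0 i| <= 2 * r) ->
  (forall i, kap < k i -> x 0 i = x' 0 i) ->
  eps_close k Theta e q x -> eps_close k Theta e q' x' -> q = q'.
Proof.
move=> k01 kap0 c0 L0 r0 hbad q0 q'0 q'L qL qY q'Y rY eL xr xk hq hq'.
apply/eqP/negP => /negP; rewrite -subr_eq0 => qq0.
have [i hi] := hbad _ qq0.
have [z hz] := hq i; have [z' hz'] := hq' i.
have /andP[ki0 ki1] := k01 i.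
have := hi (z - z'); apply/negP; rewrite -ltNge.
have a1 := supnormz_ge1 R q0; have b1 := supnormz_ge1 R q'0.
have d1 := supnormz_ge1 R qq0; have dab := supnormzB R q q'.
set a := supnormz R q in q'L qL qY a1 dab hz *.
set b := supnormz R q' in q'L qL q'Y b1 dab hz' *.
set d := supnormz R (q - q') in d1 dab *.
have ex0 : 0 <= m%:R * k i by rewrite mulr_ge0 // ltW.
have mono (u v t : R) : 0 <= u -> 0 <= t -> u <= v -> u `^ t <= v `^ t.
  by move=> u0 t0 uv; apply: ge0_ler_powR => //; rewrite nnegrE // (le_trans u0).
set w := linform Theta i q - x 0 i - z%:~R in hz *.
set w' := linform Theta i q' - x' 0 i - z'%:~R in hz' *.
have -> : linform Theta i (q - q') - (z - z')%:~R = w - w' + (x 0 i - x' 0 i).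
  by rewrite linformB rmorphB /w /w' /=; ring.
clearbody a b d w w'.
(* Passing from size [u] to size [d] costs [(1 + L)]^ (m%:R * k i)[, at most](1 + L) [^ m%:R] since
   [k i <= 1]. *)
have main (u v : R) : 1 <= u -> d <= (1 + L) * u -> u `^ (m%:R * k i) * `|v| < e ->
    d `^ (m%:R * k i) * `|v| <= c / 8.
  move=> u1 du hv.
  apply: (@le_trans _ _ ((1 + L) `^ (m%:R * k i) * (u `^ (m%:R * k i) * `|v|))).
    rewrite mulrA -powRM ?addr_ge0 //; last lra.
    by rewrite ler_wpM2r // mono //; lra.
  apply: le_trans eL; apply: ler_pM; rewrite ?powR_ge0 ?(ltW hv) //.
    by rewrite mulr_ge0 ?powR_ge0.
  by apply: ler_powR; [lra | rewrite -[leRHS]mulr1 ler_wpM2l].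
have h1 : d `^ (m%:R * k i) * `|w| <= c / 8 by apply: (main a w) => //; lra.
have h2 : d `^ (m%:R * k i) * `|w'| <= c / 8 by apply: (main b w') => //; lra.
have h3 : d `^ (m%:R * k i) * `|x 0 i - x' 0 i| <= c / 4.
  have [kk|/xk ->] := leP (k i) kap; last by rewrite subrr normr0 mulr0; lra.
  have mk0 : 0 <= m%:R * kap by rewrite mulr_ge0 // ltW.
  have dY : d `^ (m%:R * kap) <= 2 `^ (m%:R * kap) * Y.
    wlog ab : a b dab qY q'Y a1 b1 {q'L qL hz hz'} / a <= b.
      move=> H; have [ab|/ltW ba] := leP a b; first exact: (H a b).
      by apply: (H b a) => //; rewrite addrC.
    apply: (@le_trans _ _ ((2 * b) `^ (m%:R * kap))); first by apply: mono; lra.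
    by rewrite powRM ?ler_wpM2l ?powR_ge0 //; lra.
  apply: (@le_trans _ _ (2 `^ (m%:R * kap) * Y * (2 * r))).
    apply: ler_pM; rewrite ?powR_ge0 //; apply: le_trans dY.
    by apply: ler_powR => //; rewrite ler_wpM2l.
  move: rY; rewrite mulrAC => rY; lra.
have := ler_normD (w - w') (x 0 i - x' 0 i); have := ler_normB w w' => t1 t2.
have : d `^ (m%:R * k i) * `|w - w' + (x 0 i - x' 0 i)| <=
    d `^ (m%:R * k i) * (`|w| + `|w'| + `|x 0 i - x' 0 i|).
  by rewrite ler_wpM2l ?powR_ge0 //; lra.
rewrite !mulrDr; lra.
Qed.

(** * Escaping the dangerous vectors of one scale *)

Lemma powR_ge1 (R : realType) (a t : R) : 1 <= a -> 0 <= t -> 1 <= a `^ t.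
Proof. by move=> a1 t0; rewrite -[leLHS](powRr0 a) ler_powR. Qed.

Lemma avoiding_direction (R : realType) (n m : nat) (k : 'I_n -> R)
    (Theta : 'M[R]_(n, m)) (c M e s beta r : R) (p b u : 'rV[R]_n)
    (W : {vspace 'rV[R]_n}) (i0 : 'I_n) :
  let X (q : 'rV[int]_m) := supnormz R q `^ (m%:R * k i0) in
  let c' := c / 8 / 2 `^ (m%:R * k i0) in
  (0 < m)%N -> (forall i, 0 < k i <= 1) -> 0 < c <= 1 -> 0 < M -> 0 < r ->
  0 < s -> 0 < beta ->
  (forall q, q != 0 -> exists i, forall z : int,
      c <= supnormz R q `^ (m%:R * k i) * `|linform Theta i q - z%:~R|) ->
  (1 + M `^ (m%:R * k i0)^-1) `^ m%:R * e <= c / 8 ->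
  4 * M * e <= beta * s * c' ->
  u \in W -> enorm u = 1 -> (forall w, w \in W -> w 0 i0 = s * dot u w) ->
  (forall i w, w \in W -> k i0 < k i -> w 0 i = 0) ->
  affine p W b ->
  exists v, [/\ v \in W, enorm v = 1 & forall x, affine p W x ->
    enorm (x - b) <= r -> r * (beta / 2) <= dot v (x - b) ->
    forall q, q != 0 -> c' <= M * X q * r -> X q * r < c' -> ~ eps_close k Theta e q x].
Proof.
move=> X c' m0 k01 /andP[c0 c1] M0 r0 s0 beta0 hbad eL eM uW u1 us Wk bA.
have ki0 : 0 < k i0 by have /andP[] := k01 i0.
have mk0 : 0 < m%:R * k i0 by rewrite mulr_gt0 // ltr0n.
have P0 : 1 <= 2 `^ (m%:R * k i0).
  by rewrite powR_ge1 ?ler1n // ltW.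
have c'0 : 0 < c' by rewrite !divr_gt0 // powR_gt0.
have c'1 : c' <= 1 / 8.
  rewrite ler_pdivrMr ?powR_gt0 //; lra.
pose L := M `^ (m%:R * k i0)^-1.
have L0 : 0 <= L by exact: powR_ge0.
have X1 q : q != 0 -> 1 <= X q.
  by move=> q0; rewrite powR_ge1 ?supnormz_ge1 // ltW.
(* Values of [X] in the window differ by a factor at most [M]; taking roots, the norms differ by a
   factor at most [L]. *)
have Le q q' : q != 0 -> q' != 0 -> X q' * r < c' -> c' <= M * X q * r ->
    supnormz R q' <= L * supnormz R q.
  move=> q0 q'0 h1 h2; have hX : X q' <= M * X q.
    by rewrite -(ler_pM2r r0) ltW // (lt_le_trans h1).
  have root q2 : q2 != 0 -> supnormz R q2 = X q2 `^ (m%:R * k i0)^-1.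
    move=> /(supnormz_ge1 R) q1.
    by rewrite -powRrM divff ?gt_eqF // powRr1 // (le_trans ler01).
  rewrite (root q) // (root q') // /L -powRM ?powR_ge0 ?(ltW M0) //.
  apply: (ge0_ler_powR _ _ _ hX); rewrite ?nnegrE ?powR_ge0 ?invr_ge0 ?(ltW mk0) // ltW //.
  by rewrite mulr_gt0 // (lt_le_trans ltr01) // X1.
have key x x' q q' :
    affine p W x -> affine p W x' -> enorm (x - b) <= r -> enorm (x' - b) <= r ->
    q != 0 -> q' != 0 ->
    c' <= M * X q * r -> X q * r < c' -> c' <= M * X q' * r -> X q' * r < c' ->
    eps_close k Theta e q x -> eps_close k Theta e q' x' ->
    x 0 i0 - x' 0 i0 < r * (beta / 2) * s.
  move=> xA x'A xb x'b q0 q'0 Mq qc Mq' q'c hq hq'.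
  have xr i : `|x 0 i - x' 0 i| <= 2 * r.
    have := coord_le_enorm (x - x') i; rewrite !mxE.
    have := ler_enormB b x x'; rewrite (enormB b); lra.
  have E : q = q'.
    apply: (@eps_close_unique R n m k Theta c (k i0) L (c' / r) r e q q' x x') => //.
    - exact: ltW.
    - exact: Le.
    - exact: Le.
    - by rewrite ler_pdivlMr //; exact: ltW qc.
    - by rewrite ler_pdivlMr //; exact: ltW q'c.
    - rewrite -mulrA (mulrC r) divfK ?gt_eqF // /c' [leLHS]mulrC.
      by rewrite divfK // gt_eqF // powR_gt0.
    - move=> i ik; apply/eqP; rewrite -subr_eq0; apply/eqP.
      by have := Wk i (x - x') (affineB xA x'A) ik; rewrite !mxE.
  subst q'; have [z hz] := hq i0; have [z' hz'] := hq' i0.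
  rewrite -/(X q) in hz hz'; have Xq := X1 q q0.
  have e8 : e <= 1 / 8.
    have : 1 <= (1 + L) `^ m%:R.
      by rewrite powR_ge1 // lerDl.
    have [e0|/ltW e0] := leP e 0; first lra.
    move=> h; have := ler_wpM2r e0 h; rewrite -/L in eL; lra.
  set w := linform _ _ _ - x _ _ - _ in hz; set w' := linform _ _ _ - _ - _ in hz'.
  have ww : x 0 i0 - x' 0 i0 = w' - w + (z' - z)%:~R.
    by rewrite rmorphB /w /w' /=; ring.
  have wX (v : R) : `|v| <= X q * `|v| by rewrite ler_peMl.
  have rc : r <= c'.
    by apply: le_trans (ltW qc); rewrite ler_peMl // ltW.
  (* The two errors are below [1 / 8] and the coordinates differ by at most [2 * r <= 1 / 4], so the
     integers agree. *)
  have zz : z' - z = 0.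
    apply/eqP/negP => /negP zz.
    have : 1 <= `|(z' - z)%:~R : R| by rewrite norm_intr_ge1 ?intr_int // intr_eq0.
    have -> : (z' - z)%:~R = x 0 i0 - x' 0 i0 + (w - w') by rewrite ww; ring.
    have := ler_normD (x 0 i0 - x' 0 i0) (w - w'); have := ler_normB w w'.
    have := wX w; have := wX w'; have := xr i0; lra.
  rewrite ww zz addr0.
  have MX : 0 < M * X q by rewrite mulr_gt0 // (lt_le_trans ltr01).
  rewrite -(ltr_pM2l MX).
  have h1 : X q * (w' - w) < 2 * e.
    have := ler_normB w' w; have := ler_norm (w' - w) => t1 t2.
    have : X q * (w' - w) <= X q * (`|w'| + `|w|).
      by rewrite ler_wpM2l ?powR_ge0 //; lra.
    rewrite mulrDr; lra.
  have h2 : M * X q * (w' - w) < 2 * M * e.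
    by rewrite -mulrA -mulrA (mulrCA 2) ltr_pM2l.
  apply: (lt_le_trans h2).
  have := ler_wpM2r (ltW (mulr_gt0 beta0 s0)) Mq; lra.
pose bad x' q' := [/\ affine p W x', enorm (x' - b) <= r, q' != 0 &
   [/\ c' <= M * X q' * r, X q' * r < c', eps_close k Theta e q' x' &
       x' 0 i0 <= b 0 i0]].
have diff x : affine p W x -> x 0 i0 - b 0 i0 = s * dot u (x - b).
  by move=> xA; rewrite -(us _ (affineB xA bA)) !mxE.
have [[x' [q' [x'A x'b q'0 [Mq' q'c hq' x'b0]]]]|nobad] :=
    pselect (exists x' q', bad x' q').
  exists u; split=> // x xA xb ux q q0 Mq qc hq.
  have := key x x' q q' xA x'A xb x'b q0 q'0 Mq qc Mq' q'c hq hq'.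
  have := ler_wpM2l (ltW s0) ux; rewrite -diff //; lra.
exists (- u); split; [by rewrite memvN | by rewrite enormN |].
move=> x xA xb ux q q0 Mq qc hq; apply: nobad; exists x, q; split=> //; split=> //.
have rb : 0 < r * (beta / 2) by rewrite mulr_gt0 // divr_gt0.
have : 0 <= s * dot (- u) (x - b) by rewrite mulr_ge0 ?ltW // (lt_le_trans rb).
by rewrite dotC dotNr dotC mulrN -diff //; lra.
Qed.

(** Take the least [t] giving the upper bound. If [t > 0], minimality at the previous stage gives
    the lower bound, as [1 <= M * rho]. If [t = 0], it follows from [c / r0 <= M] and [1 <= X]: this
    is how the first stage absorbs all small vectors. *)
Lemma least_stage (R : realType) (c r0 rho M : R) (X : R) :
  0 < rho < 1 -> 0 < c -> 0 < r0 -> 1 <= X -> rho^-1 + c / r0 <= M ->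
  exists t, c <= M * X * (r0 * rho ^+ t) /\ X * (r0 * rho ^+ t) < c.
Proof.
move=> /andP[rho0 rho1] c0 r00 X1 hM.
have X0 : 0 < X by lra.
have ex : exists t, X * (r0 * rho ^+ t) < c.
  have [||t ht] := @geometric_small R (X * r0) rho (c / 2).
  - by rewrite ltW.
  - lra.
  - by exists t; rewrite mulrA; lra.
have cr0 : 0 < c / r0 by rewrite divr_gt0.
have ir0 : 0 < rho^-1 by rewrite invr_gt0.
case: (ex_minnP ex) => t ht tmin; exists t; split=> //.
case: t ht tmin => [|t] ht tmin.
  rewrite expr0 mulr1; apply: (@le_trans _ _ (M * r0)).
    by rewrite -ler_pdivrMr //; lra.
  by rewrite ler_pM2r // ler_peMr //; lra.
have : c <= X * (r0 * rho ^+ t).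
  by rewrite leNgt; apply/negP => /tmin; rewrite ltnn.
move=> /le_trans; apply.
have -> : M * X * (r0 * rho ^+ t.+1) = M * rho * (X * (r0 * rho ^+ t)).
  by rewrite exprS; ring.
rewrite ler_peMl //; first by rewrite !mulr_ge0 ?exprn_ge0 ?ltW.
by rewrite -ler_pdivrMr //; lra.
Qed.

(** * Choice of the coordinate and of the constants *)

Unset Implicit Arguments.
Set Strict Implicit.

Theorem theorem2p4 (R : realType) (n m : nat) (hn : (1 <= n)%N) (hm : (1 <= m)%N)
    (k : 'I_n -> R) (k_gt0 : forall i : 'I_n, 0 < k i)
    (k_sum : \sum_(i < n) k i = 1)
    (Theta : 'M[R]_(n, m)) (hTheta : Bad k Theta) :
  isotropically_winning (BadTheta k Theta).
Proof.
move=> d /andP[d1 _] _ [p [W [dimW ->]]] beta beta01.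
rewrite -/(affine p W).
have /andP[beta0 beta1] := beta01.
have k01 i : 0 < k i <= 1.
  rewrite k_gt0 /= -k_sum (bigD1 i) //= lerDl.
  by apply: sumr_ge0 => j _; exact: ltW.
have [c1 c10 hc1] := Bad_lower_bound hTheta.
(* Truncation at [1] keeps [c'] and [e] at most [1 / 8], which forces nearby integers to
   coincide. *)
pose c := Num.min c1 1.
have c01 : 0 < c <= 1 by rewrite lt_min c10 ltr01 ge_min lexx orbT.
have hbad q : q != 0 -> exists i, forall z : int,
    c <= supnormz R q `^ (m%:R * k i) * `|linform Theta i q - z%:~R|.
  by move=> /hc1[i hi]; exists i => z; apply: le_trans (hi z); rewrite ge_min lexx.
pose moves i := `[< exists2 w, w \in W & w 0 i != 0 >].
have [i1 movesi1] : exists i, moves i.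
  have W0 : W != 0%VS by rewrite -dimv_eq0 dimW -lt0n.
  have : vpick W != 0 by rewrite vpick0.
  by move=> /rV0Pn[i wi]; exists i; apply/asboolP; exists (vpick W); rewrite ?memv_pick.
have [i0 /asboolP[w0 w0W w0i0] i0max] := arg_maxP k movesi1.
have Wk i w : w \in W -> k i0 < k i -> w 0 i = 0.
  move=> wW; apply: contraPeq => wi; apply/negP; rewrite -leNgt.
  by apply: i0max; apply/asboolP; exists w.
have [v vW vE] := coord_riesz W i0.
have s0 : 0 < enorm v.
  rewrite lt_def enorm_ge0 andbT; apply: contra w0i0 => /eqP/enorm_eq0 v0.
  by rewrite -vE // v0 -(scale0r 0) dotZl mul0r.
(* The unit direction of fastest growth of coordinate [i0] in [W]; its rate is [s = enorm v]. *)
pose u := (enorm v)^-1 *: v.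
have uW : u \in W by exact: memvZ.
have u1 : enorm u = 1 by rewrite enormZ gtr0_norm ?invr_gt0 // mulVf ?gt_eqF.
have us w : w \in W -> w 0 i0 = enorm v * dot u w.
  by move=> wW; rewrite -vE // dotZl mulVKf ?gt_eqF.
have /andP[c0 _] := c01.
pose X (q : 'rV[int]_m) := supnormz R q `^ (m%:R * k i0).
pose c' := c / 8 / 2 `^ (m%:R * k i0).
have c'0 : 0 < c' by rewrite !divr_gt0 // powR_gt0.
(* The contraction of Bob's radius over two rounds, that is, over one goal. *)
pose rho := (beta / 2) ^+ 2.
have b20 : 0 < beta / 2 by lra.
have rho01 : 0 < rho < 1 by rewrite exprn_gt0 // expr_lt1 // ?ltW //; lra.
have /andP[rho0 _] := rho01.
apply: push_twice_winning => // r0 r00.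
pose M := rho^-1 + c' / r0.
have M0 : 0 < M by rewrite addr_gt0 ?divr_gt0 ?invr_gt0.
pose N := (1 + M `^ (m%:R * k i0)^-1) `^ m%:R.
have N0 : 0 < N by rewrite powR_gt0 // ltr_pwDl // powR_ge0.
(* The first bound makes the dangerous vector unique; the second makes its slab thin enough to be
   escaped. *)
pose e := Num.min (c / 8 / N) (beta * enorm v * c' / (4 * M)).
have e0 : 0 < e by rewrite lt_min !divr_gt0 ?mulr_gt0.
have eN : N * e <= c / 8.
  by rewrite mulrC -ler_pdivlMr // ge_min lexx.
have eM : 4 * M * e <= beta * enorm v * c'.
  by rewrite mulrC -ler_pdivlMr ?mulr_gt0 // ge_min lexx orbT.
exists (fun t => [set x | forall q, q != 0 -> c' <= M * X q * (r0 * rho ^+ t) ->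
  X q * (r0 * rho ^+ t) < c' -> ~ eps_close k Theta e q x]); split.
  move=> x xA hx; split=> //; apply: (not_eps_close_BadTheta hm e0) => q q0.
  have Xq : 1 <= X q.
    by rewrite powR_ge1 ?supnormz_ge1 // mulr_ge0 // ltW.
  have [t [h1 h2]] := @least_stage R c' r0 rho M (X q) rho01 c'0 r00 Xq (lexx _).
  exact: (hx t).
move=> t b bA; rewrite -mul2n exprM.
apply: (avoiding_direction hm k01 c01 M0 _ s0 _ _ _ _ uW) => //.
by rewrite mulr_gt0 ?exprn_gt0.
Qed.
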